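(* Let $\lambda\in\overline{\mathrm{Pr}}_k$ and $\mu\in W\cdot\lambda$. Then $\mu\in\overline{\mathrm{Pr}}_k$ if and only if $\mu$ is dominant.
   Context: Let $\mathfrak g=\mathfrak{sl}_{n+1}(\mathbb C)$, $n\ge1$, $\mathfrak h$ the traceless diagonal matrices, $\Delta_+=\{\varepsilon_i-\varepsilon_j:i<j\}$, $\Delta_-=-\Delta_+$, $\alpha_i=\varepsilon_i-\varepsilon_{i+1}$; $(\cdot,\cdot)$ the invariant form on $\mathfrak h^*$ with $(\alpha,\alpha)=2$ for roots, $\langle\mu,\alpha^\vee\rangle=(\mu,\alpha)$; $\omega_i$ fundamental weights, $P^\vee=\bigoplus\mathbb Z\omega_i$, $\rho=\sum\omega_i$; $W$ the Weyl group, $w\cdot\mu=w(\mu+\rho)-\rho$. A weight $\mu\in\mathfrak h^*$ is dominant if $\langle\mu+\rho,\alpha^\vee\rangle\notin\{-1,-2,-3,\dots\}$ for all $\alpha\in\Delta_+$. Fix $k\in\mathbb Q$ with $k+n+1=p/q$, $p,q\in\mathbb N$ coprime, $p\ge n+1$. $\overline{\mathrm{Pr}}_{k,\mathbb Z}=\{\sum\lambda_i\omega_i:\lambda_i\in\mathbb N_0,\sum\lambda_i\le p-n-1\}$. For $w\in W,\eta\in P^\vee$, $C(w,\eta)$ means: for all $\alpha\in\Delta_+$, $0\le(\eta,\alpha)\le q-1$ if $w(\alpha)\in\Delta_+$ and $1\le(\eta,\alpha)\le q$ if $w(\alpha)\in\Delta_-$. The admissible weights of level $k$: $\overline{\mathrm{Pr}}_k=\{w\cdot(\mu-\tfrac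 pq\eta):\mu\in\overline{\mathrm{Pr}}_{k,\mathbb Z},w\in W,\eta\in P^\vee,C(w,\eta)\}$. *)

(* Defs.v *)
From HB Require Import structures.
From mathcomp Require Import all_boot all_order all_algebra all_fingroup.
Set Implicit Arguments. Unset Strict Implicit. Unset Printing Implicit Defensive.
Import Order.TTheory GRing.Theory Num.Theory.
Local Open Scope ring_scope.

(* A weight mu = \sum_l mu_l omega_l of sl_{n+1}, stored by its coordinates
   mu_l = <mu, alpha_l^vee> in the basis of fundamental weights
   (index l : 'I_n stands for alpha_{l+1}). *)
Definition weight (n : nat) := {ffun 'I_n -> rat}.

(* epsilon-coordinates: mu = \sum_{i=0}^{n} x_i eps_i with x_i = \sum_{l>=i} mu_l
   (normalised so that x_n = 0). *)
Definition epsc (n : nat) (mu : weight n) (i : 'I_n.+1) : rat :=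
  \sum_(l < n | (i <= l)%N) mu l.

(* <mu, alpha^vee> for the positive root alpha = eps_i - eps_j, i < j. *)
Definition pairing (n : nat) (mu : weight n) (i j : 'I_n.+1) : rat :=
  epsc mu i - epsc mu j.

(* the two epsilon-indices l and l+1 of the simple root alpha_l *)
Definition lo (n : nat) (l : 'I_n) : 'I_n.+1 := widen_ord (leqnSn n) l.
Definition hi (n : nat) (l : 'I_n) : 'I_n.+1 := lift ord0 l.

(* Weyl group W = S_{n+1}, acting by w(eps_i) = eps_{w i}. *)
Definition wact (n : nat) (w : 'S_n.+1) (mu : weight n) : weight n :=
  [ffun l : 'I_n => epsc mu ((w^-1)%g (lo l)) - epsc mu ((w^-1)%g (hi l))].

Definition rho (n : nat) : weight n := [ffun _ => 1].

Definition wadd (n : nat) (a b : weight n) : weight n := [ffun l => a l + b l].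
Definition wsub (n : nat) (a b : weight n) : weight n := [ffun l => a l - b l].

Definition dot (n : nat) (w : 'S_n.+1) (mu : weight n) : weight n :=
  wsub (wact w (wadd mu (rho n))) (rho n).

Definition dominant (n : nat) (mu : weight n) : Prop :=
  forall i j : 'I_n.+1, (i < j)%N ->
    ~ (exists m : nat, pairing (wadd mu (rho n)) i j = - (m.+1)%:R).

Definition PrZ (n p : nat) (mu : weight n) : Prop :=
  (forall l, exists m : nat, mu l = m%:R) /\
  \sum_(l < n) mu l <= (p%:R - n%:R - 1 : rat).

(* coweight eta in P^vee = \oplus Z omega_i, viewed as a weight *)
Definition coweight (n : nat) := {ffun 'I_n -> int}.
Definition cw (n : nat) (eta : coweight n) : weight n := [ffun l => (eta l)%:~R].

(* condition C(w, eta); (eta, eps_i - eps_j) = pairing, w(alpha) > 0 iff w i < w j *)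
Definition condC (n q : nat) (w : 'S_n.+1) (eta : coweight n) : Prop :=
  forall i j : 'I_n.+1, (i < j)%N ->
    let v := pairing (cw eta) i j in
    if (w i < w j)%N then 0 <= v <= (q%:R - 1) else 1 <= v <= q%:R.

(* admissible weights of level k with k + n + 1 = p/q *)
Definition admissible (n p q : nat) (lam : weight n) : Prop :=
  exists (mu : weight n) (w : 'S_n.+1) (eta : coweight n),
    PrZ p mu /\ condC q w eta /\
    lam = dot w (wsub mu [ffun l => (p%:R / q%:R) * cw eta l]).
Arguments admissible : clear implicits.

(* Main.v *)
Require Import Defs.
From HB Require Import structures.
From mathcomp Require Import all_boot all_order all_algebra all_fingroup.
From mathcomp Require Import zify ring lra.
Set Implicit Arguments. Unset Strict Implicit. Unset Printing Implicit Defensive.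
Import Order.TTheory GRing.Theory Num.Theory.
Local Open Scope ring_scope.

(* Write an admissible weight as  V . X  with  X = nu - (p/q) eta,  nu in
   Pr_{k,Z} and C(V, eta).  For a positive root alpha = eps_a - eps_b (a < b)
   the dot action gives  <V . X + rho, (V alpha)^vee> = k - (p/q) z  where
   k = <nu + rho, alpha^vee> lies in (0, p) and z = (eta, alpha) is an integer
   in [0, q].  Since p and q are coprime, k - (p/q) z is a negative integer iff
   z = q, and a positive integer iff z = 0.  Hence dominance of V . X, read
   root by root through the relabelling alpha -> V alpha, is exactly the
   condition C(V, eta) (which only forbids z = q or z = 0 depending on the sign
   of V alpha).  The theorem follows: an admissible weight is dominant, and a
   dominant weight  w . lam = (y w) . X  in the orbit of an admissible
   lam = y . X  satisfies C(y w, eta), hence is admissible. *)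

Section WeylAction.
Variable n : nat.
Implicit Types (w y : 'S_n.+1) (X Z : weight n).

Lemma lo_inord (l : 'I_n) : lo l = inord l.
Proof. by apply: val_inj; rewrite /= inordK // ltnS ltnW. Qed.

Lemma hi_inord (l : 'I_n) : hi l = inord l.+1.
Proof. by apply: val_inj; rewrite /= inordK ?ltnS. Qed.

Lemma sum_simple_roots (f : 'I_n.+1 -> rat) (i : 'I_n.+1) :
  \sum_(l < n | (i <= l)%N) (f (lo l) - f (hi l)) = f i - f ord_max.
Proof.
pose F k := f (inord k).
transitivity (\sum_(l < n | true && (i <= l)%N) (- (F l.+1 - F l))).
  by apply: eq_bigr => l _; rewrite opprB /F lo_inord hi_inord.
rewrite -(big_geq_mkord i n xpredT (fun l => - (F l.+1 - F l))) sumrN.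
rewrite telescope_sumr ?opprB /F; last by rewrite -ltnS.
by congr (f _ - f _); apply: val_inj; rewrite /= inordK.
Qed.

Lemma epsc_wact w X i :
  epsc (wact w X) i = epsc X ((w^-1)%g i) - epsc X ((w^-1)%g ord_max).
Proof.
rewrite {1}/epsc; under eq_bigr => l _ do rewrite ffunE.
exact: (sum_simple_roots (fun k => epsc X ((w^-1)%g k))).
Qed.

Lemma pairing_wact w X i j :
  pairing (wact w X) i j = pairing X ((w^-1)%g i) ((w^-1)%g j).
Proof. by rewrite /pairing !epsc_wact; ring. Qed.

(* wact is a right action of 'S_(n+1); so is the dot action, hence a dot orbit
   is closed under further dot actions. *)
Lemma wact_comp w y X : wact w (wact y X) = wact (y * w)%g X.
Proof. by apply/ffunP => l; rewrite !ffunE !epsc_wact !invMg !permM; ring. Qed.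

Lemma wadd_wsub X Z : wadd (wsub X Z) Z = X.
Proof. by apply/ffunP => l; rewrite !ffunE subrK. Qed.

Lemma dot_comp w y X : dot w (dot y X) = dot (y * w)%g X.
Proof. by rewrite /dot wadd_wsub wact_comp. Qed.

Lemma pairing_dot w X i j :
  pairing (wadd (dot w X) (rho n)) i j =
  pairing (wadd X (rho n)) ((w^-1)%g i) ((w^-1)%g j).
Proof. by rewrite /dot wadd_wsub pairing_wact. Qed.

End WeylAction.

Lemma pairing_anti n (X : weight n) i j : pairing X j i = - pairing X i j.
Proof. by rewrite /pairing opprB. Qed.

Lemma pairing_shift n (nu : weight n) (c : rat) (eta : coweight n) i j :
  pairing (wadd (wsub nu [ffun l => c * cw eta l]) (rho n)) i j =
  pairing (wadd nu (rho n)) i j - c * pairing (cw eta) i j.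
Proof.
have epscE k : epsc (wadd (wsub nu [ffun l => c * cw eta l]) (rho n)) k =
               epsc (wadd nu (rho n)) k - c * epsc (cw eta) k.
  by rewrite /epsc mulr_sumr -sumrB; apply: eq_bigr => l _; rewrite !ffunE; ring.
by rewrite /pairing !epscE; ring.
Qed.

Lemma pairing_cw_int n (eta : coweight n) i j :
  exists t : int, pairing (cw eta) i j = t%:~R.
Proof.
exists ((\sum_(l < n | (i <= l)%N) eta l) - \sum_(l < n | (j <= l)%N) eta l).
rewrite /pairing /epsc rmorphB /= !rmorph_sum /=.
by congr (_ - _); apply: eq_bigr => l _; rewrite ffunE.
Qed.

Lemma pairing_interval n (X : weight n) (a b : 'I_n.+1) : (a <= b)%N ->
  pairing X a b = \sum_(l < n | (a <= l < b)%N) X l.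
Proof.
move=> le_ab; rewrite /pairing /epsc (bigID (fun l : 'I_n => (l < b)%N)) /=.
rewrite [X in _ - X](eq_bigl (fun l : 'I_n => (a <= l)%N && ~~ (l < b)%N)) ?addrK //.
move=> l; rewrite -leqNgt; apply/idP/andP => [le_bl|[] //].
by split=> //; exact: leq_trans le_ab le_bl.
Qed.

Lemma pairing_PrZ n p (nu : weight n) (a b : 'I_n.+1) :
  PrZ p nu -> (a < b)%N ->
  exists k : nat, pairing (wadd nu (rho n)) a b = k%:R /\ (0 < k)%N /\ (k < p)%N.
Proof.
move=> [nu_nat nu_sum] lt_ab.
have X_ge1 l : 1 <= wadd nu (rho n) l.
  by rewrite !ffunE; have [m ->] := nu_nat l; rewrite lerDr ler0n.
have X_nat l : wadd nu (rho n) l \is a Num.nat.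
  by rewrite !ffunE; have [m ->] := nu_nat l; rewrite rpredD ?nat_num1 ?natr_nat.
set K := pairing _ a b.
have K_nat : K \is a Num.nat.
  by rewrite /K (pairing_interval _ (ltnW lt_ab)); apply: rpred_sum => l _.
have K_ge1 : 1 <= K.
  have a_lt_n : (a < n)%N by rewrite -ltnS; exact: leq_trans lt_ab (ltn_ord b).
  rewrite /K (pairing_interval _ (ltnW lt_ab)) (bigD1 (Ordinal a_lt_n)) ?leqnn //=.
  rewrite -[1]addr0 lerD //; apply: sumr_ge0 => l _; exact: le_trans (X_ge1 l).
have K_lt_p : K < p%:R.
  have total : \sum_(l < n) wadd nu (rho n) l = \sum_(l < n) nu l + n%:R.
    rewrite (eq_bigr (fun l => nu l + 1)) ?big_split ?sumr_const ?card_ord //=.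
    by move=> l _; rewrite !ffunE.
  have : K <= \sum_(l < n) wadd nu (rho n) l.
    rewrite /K (pairing_interval _ (ltnW lt_ab)).
    rewrite [leRHS](bigID (fun l : 'I_n => (a <= l < b)%N)) /=.
    by rewrite lerDl sumr_ge0 // => l _; exact: le_trans (X_ge1 l).
  by rewrite total; lra.
have /natrP [k Ek] := K_nat.
by exists k; move: K_ge1 K_lt_p; rewrite Ek ler1n ltr_nat.
Qed.

Definition neg_integer (x : rat) : Prop := exists m : nat, x = - (m.+1)%:R.

Section ShiftedValue.
Variables (p q k : nat).
Hypotheses (coprime_pq : coprime p q) (q_gt0 : (0 < q)%N)
  (k_gt0 : (0 < k)%N) (k_lt_p : (k < p)%N).

Definition shifted (t : int) : rat := k%:R - p%:R / q%:R * t%:~R.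

(* q (k - (p/q) t) = k q - p t forces q | p t, hence q | t. *)
Lemma shifted_int_window (t x : int) : 0 <= t <= q%:Z ->
  shifted t = x%:~R -> t = 0 \/ t = q%:Z.
Proof.
move=> /andP [t_ge0 t_leq] Ex.
have q_neq0 : (q%:R : rat) != 0 by rewrite pnatr_eq0 -lt0n.
have Eint : (k%:Z * q%:Z - p%:Z * t = x * q%:Z)%R.
  apply: (@intr_inj rat); rewrite !rmorphB !rmorphM /= -Ex /shifted.
  by field.
have q_dvd_t : (q%:Z %| t)%Z.
  have coprime_qp : coprimez q%:Z p%:Z by rewrite coprimezE /= coprime_sym.
  rewrite -(Gauss_dvdzr _ coprime_qp); apply/dvdzP; exists (k%:Z - x).
  by rewrite mulrBl -Eint; ring.
case/dvdzP: q_dvd_t => s ts; subst t.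
by have [s_le0|s_gt0] := lerP s 0; [left | right]; nia.
Qed.

Lemma shifted0 : shifted 0 = k%:R.
Proof. by rewrite /shifted mulr0 subr0. Qed.

Lemma shiftedq : shifted q%:Z = k%:R - p%:R.
Proof.
have q_neq0 : (q%:R : rat) != 0 by rewrite pnatr_eq0 -lt0n.
by rewrite /shifted -[(q%:Z)%:~R]/(q%:R : rat) divfK.
Qed.

Lemma neg_integer_shifted (t : int) : 0 <= t <= q%:Z ->
  neg_integer (shifted t) <-> t = q%:Z.
Proof.
move=> t_win; split => [[m Em]|->].
- have Ex : shifted t = (- (m.+1)%:Z)%:~R by rewrite Em rmorphN.
  have [t0|//] := shifted_int_window t_win Ex.
  move: Em; rewrite t0 shifted0 => Em.
  by move: (ler0n rat k); rewrite Em oppr_ge0 leNgt ltr0Sn.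
- exists (p - k).-1; rewrite shiftedq prednK ?subn_gt0 // natrB ?(ltnW k_lt_p) //.
  ring.
Qed.

Lemma pos_integer_shifted (t : int) : 0 <= t <= q%:Z ->
  neg_integer (- shifted t) <-> t = 0.
Proof.
move=> t_win; split => [[m Em]|->].
- have Ex : shifted t = (m.+1)%:Z%:~R by apply: oppr_inj; rewrite Em.
  have [//|tq] := shifted_int_window t_win Ex.
  have Ekp : (k%:R - p%:R : rat) = (m.+1)%:R by rewrite -shiftedq -tq Ex.
  have : (k.+1%:R <= p%:R :> rat) by rewrite ler_nat.
  rewrite -addn1 natrD => kp; exfalso; have := ltr0Sn rat m; lra.
- by exists k.-1; rewrite shifted0 prednK.
Qed.

End ShiftedValue.

Lemma window_below_top (q : nat) (t : int) : 0 <= t <= q%:Z ->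
  (0 <= (t%:~R : rat) <= q%:R - 1) <-> t <> q%:Z.
Proof.
move=> t_win; rewrite -[q%:R]/((q%:Z)%:~R : rat) -[1]/(1%:~R : rat) -rmorphB.
rewrite -[0]/(0%:~R : rat) !ler_int; split => [/andP[]|]; lia.
Qed.

Lemma window_above_bottom (q : nat) (t : int) : 0 <= t <= q%:Z ->
  (1 <= (t%:~R : rat) <= q%:R) <-> t <> 0.
Proof.
move=> t_win; rewrite -[q%:R]/((q%:Z)%:~R : rat) -[1]/(1%:~R : rat) !ler_int.
split => [/andP[]|]; lia.
Qed.

Lemma dominant_relabel n (V : 'S_n.+1) (mu : weight n) :
  dominant mu <-> forall a b : 'I_n.+1, (a < b)%N ->
    let x := pairing (wadd mu (rho n)) (V a) (V b) in
    if (V a < V b)%N then ~ neg_integer x else ~ neg_integer (- x).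
Proof.
split => [dom a b lt_ab /=|rel i j lt_ij].
  case: ifP => [lt_V|ge_V]; first exact: dom.
  rewrite -pairing_anti; apply: dom.
  have neq_V : V b != V a by rewrite (inj_eq perm_inj) -val_eqE /= gtn_eqF.
  by rewrite ltn_neqAle neq_V leqNgt ge_V.
have Vi : V ((V^-1)%g i) = i by rewrite permKV.
have Vj : V ((V^-1)%g j) = j by rewrite permKV.
case: (ltngtP ((V^-1)%g i) ((V^-1)%g j)) => [lt_ab|lt_ba|eq_ab].
- by have := rel _ _ lt_ab; rewrite /= Vi Vj lt_ij.
- have := rel _ _ lt_ba; rewrite /= Vi Vj ltnNge (ltnW lt_ij) /=.
  by rewrite pairing_anti opprK.
- by move: lt_ij; rewrite -Vi -Vj (val_inj eq_ab) ltnn.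
Qed.

(* The common consequence of both branches of C(V, eta): 0 <= (eta, alpha) <= q. *)
Definition cw_window (n q : nat) (eta : coweight n) : Prop :=
  forall a b : 'I_n.+1, (a < b)%N -> 0 <= pairing (cw eta) a b <= q%:R.

Lemma condC_window n q (V : 'S_n.+1) (eta : coweight n) :
  condC q V eta -> cw_window q eta.
Proof.
move=> HC a b lt_ab; move: (HC a b lt_ab) => /=.
by case: ifP => _ /andP [lo_v hi_v]; apply/andP; split; lra.
Qed.

Section Characterization.
Variables (n p q : nat) (nu : weight n) (eta : coweight n) (V : 'S_n.+1).
Hypotheses (coprime_pq : coprime p q) (q_gt0 : (0 < q)%N)
  (nu_PrZ : PrZ p nu) (eta_window : cw_window q eta).

Let X := wsub nu [ffun l => p%:R / q%:R * cw eta l].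

Lemma root_condition (a b : 'I_n.+1) : (a < b)%N ->
  let x := pairing (wadd (dot V X) (rho n)) (V a) (V b) in
  let z := pairing (cw eta) a b in
  (if (V a < V b)%N then ~ neg_integer x else ~ neg_integer (- x)) <->
  (if (V a < V b)%N then 0 <= z <= q%:R - 1 else 1 <= z <= q%:R).
Proof.
move=> lt_ab /=; rewrite pairing_dot !permK pairing_shift.
have [k [Ek [k_gt0 k_lt_p]]] := pairing_PrZ nu_PrZ lt_ab.
have [t Et] := pairing_cw_int eta a b.
have t_win : 0 <= t <= q%:Z.
  move: (eta_window lt_ab).
  by rewrite Et -[q%:R]/((q%:Z)%:~R : rat) -[0]/(0%:~R : rat) !ler_int.
rewrite Ek Et -/(shifted p q k t).
have top := neg_integer_shifted coprime_pq q_gt0 k_gt0 k_lt_p t_win.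
have bottom := pos_integer_shifted coprime_pq q_gt0 k_gt0 k_lt_p t_win.
have below := window_below_top t_win; have above := window_above_bottom t_win.
by case: ifP => _; tauto.
Qed.

Lemma dominant_iff_condC : dominant (dot V X) <-> condC q V eta.
Proof.
rewrite (dominant_relabel V).
by split => H a b lt_ab; apply/(root_condition lt_ab); exact: H.
Qed.

End Characterization.

Theorem mainTheorem6 (n p q : nat) (hn : (1 <= n)%N) (hq : (0 < q)%N)
  (hpq : coprime p q) (hp : (n.+1 <= p)%N)
  (lam : weight n) (hlam : admissible n p q lam)
  (w : 'S_n.+1) (mu : weight n) (hmu : mu = dot w lam) :
  admissible n p q mu <-> dominant mu.
Proof.
split.
- case=> nu [V [eta [nu_PrZ [HC ->]]]].
  exact: (dominant_iff_condC V hpq hq nu_PrZ (condC_window HC)).2 HC.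
- case: hlam => nu [y [eta [nu_PrZ [HC lamE]]]] dom_mu.
  have muE : mu = dot (y * w)%g (wsub nu [ffun l => p%:R / q%:R * cw eta l]).
    by rewrite hmu lamE dot_comp.
  exists nu, (y * w)%g, eta; split=> //; split=> //.
  by apply: (dominant_iff_condC _ hpq hq nu_PrZ (condC_window HC)).1; rewrite -muE.
Qed.
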